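(* Suppose all groups are interior, i.e. $1\le y_j\le n_j-1$ for every $j=1,\dots,k$. Let $f$ be any proper hyper-prior probability density function on $(0,\infty)$ for $r$, and independently let $\boldsymbol\beta$ have the improper flat hyper-prior density $g(\boldsymbol\beta)\propto 1$ on $\mathbf R^m$. Then the joint posterior density function of the hyper-parameters, $\pi_{\mathrm{hyp.post}}(r,\boldsymbol\beta\mid\boldsymbol y)\propto f(r)\,g(\boldsymbol\beta)\,L(r,\boldsymbol\beta)$, is proper if and only if $\operatorname{rank}(\boldsymbol X)=m$.
   Context: Beta-Binomial-Logit model. There are $k\ge 1$ groups; group $j$ has an integer number of trials $n_j\ge 1$, an observed number of successes $y_j\in\{0,1,\dots,n_j\}$, and a fixed covariate vector $\boldsymbol x_j\in\mathbf R^m$, with $k\ge m\ge 1$. Put $\boldsymbol y=(y_1,\dots,y_k)^\top$ and let $\boldsymbol X=(\boldsymbol x_1,\dots,\boldsymbol x_k)^\top$ be the $k\times m$ covariate matrix. The hyper-parameters are $r\in(0,\infty)$ and $\boldsymbol\beta\in\mathbf R^m$. Write $$p^E_j=p^E_j(\boldsymbol\beta)=\frac{\exp(\boldsymbol x_j^\top\boldsymbol\beta)}{1+\exp(\boldsymbol x_j^\top\boldsymbol\beta)},\qquad q^E_j=1-p^E_j .$$ The likelihood function (a product of Beta-Binomial probability mass functions) is $$L(r,\boldsymbol\beta)=\prod_{j=1}^k\binom{n_j}{y_j}\frac{B(y_j+rp^E_j,\;n_j-y_j+rq^E_j)}{B(rp^E_j,\;rq^E_j)},$$ where $B(a,b)=\int_0^1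 v^{a-1}(1-v)^{b-1}\,dv$ for $a,b>0$ is the beta function. Given hyper-prior densities $f(r)$ and $g(\boldsymbol\beta)$ (possibly improper), the posterior $\pi_{\mathrm{hyp.post}}(r,\boldsymbol\beta\mid\boldsymbol y)\propto f(r)g(\boldsymbol\beta)L(r,\boldsymbol\beta)$ is called proper if $\int_{\mathbf R^m}\int_0^\infty f(r)g(\boldsymbol\beta)L(r,\boldsymbol\beta)\,dr\,d\boldsymbol\beta<\infty$ and improper if this integral is infinite. *)

(* Defs.v *)
From HB Require Import structures.
From mathcomp Require Import all_boot all_order all_algebra.
From mathcomp Require Import all_classical all_reals all_analysis.
Set Implicit Arguments.
Unset Strict Implicit.
Unset Printing Implicit Defensive.
Import Order.TTheory GRing.Theory Num.Theory.
Import numFieldNormedType.Exports.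
Local Open Scope classical_set_scope.
Local Open Scope ring_scope.

Section LebesgueTuple.
Context {R : realType}.

Definition tuple_cons m (p : measurableTypeR R * m.-tuple R) :
  m.+1.-tuple R := [the m.+1.-tuple R of p.1 :: p.2].

Lemma measurable_tuple_cons m : measurable_fun setT (@tuple_cons m).
Proof. exact: measurable_cons. Qed.

Section Step.
Variables (m : nat) (mu : {sigma_finite_measure set (m.-tuple R) -> \bar R}).

Definition lebesgue_cons : set (m.+1.-tuple R) -> \bar R :=
  pushforward (@lebesgue_measure R \x mu)%E (@tuple_cons m).

Let lebesgue_cons0 : lebesgue_cons set0 = 0%E.
Proof. by rewrite /lebesgue_cons /pushforward preimage_set0 measure0. Qed.

Let lebesgue_cons_ge0 A : (0 <= lebesgue_cons A)%E.
Proof. by rewrite /lebesgue_cons /pushforward; apply: measure_ge0. Qed.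

Let lebesgue_cons_sigma_additive : semi_sigma_additive lebesgue_cons.
Proof.
have mc A : measurable A -> measurable (@tuple_cons m @^-1` A).
  by move=> mA; rewrite -[X in measurable X]setTI; exact: measurable_tuple_cons.
move=> F mF tF mUF; rewrite /lebesgue_cons /pushforward preimage_bigcup.
apply: measure_semi_sigma_additive.
- by move=> i; exact: mc.
- apply/trivIsetP => /= i j _ _ ij; rewrite -preimage_setI.
  by move/trivIsetP : tF => /(_ _ _ _ _ ij) ->//; rewrite preimage_set0.
- by rewrite -preimage_bigcup; exact: mc.
Qed.

HB.instance Definition _ := isMeasure.Build _ _ _ lebesgue_cons
  lebesgue_cons0 lebesgue_cons_ge0 lebesgue_cons_sigma_additive.

Let lebesgue_cons_sigma_finite : sigma_finite setT lebesgue_cons.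
Proof.
have /sigma_finiteP[F [FT Fnd Foo]] := sigma_finiteT (@lebesgue_measure R).
have /sigma_finiteP[G [GT Gnd Goo]] := sigma_finiteT mu.
pose h (t : m.+1.-tuple R) : measurableTypeR R * m.-tuple R :=
  (thead t, [tuple of behead t]).
have mh : measurable_fun setT h.
  apply/measurable_fun_pairP => /=; split; last exact: measurable_behead.
  exact: (@measurable_tnth _ _ m.+1 ord0).
exists (fun i => h @^-1` (F i `*` G i)).
  rewrite -preimage_bigcup; apply/seteqP; split=> // t _ /=.
  have [i _ Fi] : (\bigcup_i F i) (h t).1 by rewrite -FT.
  have [j _ Gj] : (\bigcup_i G i) (h t).2 by rewrite -GT.
  exists (maxn i j) => //; split.
    by move: Fi; exact/subsetPset/Fnd/leq_maxl.
  by move: Gj; exact/subsetPset/Gnd/leq_maxr.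
move=> i; have [mF Fi] := Foo i; have [mG Gi] := Goo i; split.
  by rewrite -[X in measurable X]setTI; apply: mh => //; exact: measurableX.
rewrite /lebesgue_cons /pushforward -comp_preimage.
rewrite (_ : h \o _ = id); last first.
  by rewrite funeqE => -[x t]/=; congr pair; exact/val_inj.
by rewrite preimage_id product_measure1E// lte_mul_pinfty// ge0_fin_numE.
Qed.

HB.instance Definition _ :=
  Measure_isSigmaFinite.Build _ _ _ lebesgue_cons lebesgue_cons_sigma_finite.

End Step.

(* The [m]-dimensional Lebesgue measure on R^m, represented as [m.-tuple R];
   see [lebesgue_tuple_box]. *)
Fixpoint lebesgue_tuple (m : nat) :
    {sigma_finite_measure set (m.-tuple R) -> \bar R} :=
  match m with
  | 0 => [the {sigma_finite_measure set (0.-tuple R) -> \bar R} of \d_[tuple]]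
  | m'.+1 => [the {sigma_finite_measure set (m'.+1.-tuple R) -> \bar R} of
               lebesgue_cons (lebesgue_tuple m')]
  end.

Lemma lebesgue_tuple_box m (A : 'I_m -> set R) :
  (forall i, measurable (A i)) ->
  lebesgue_tuple m [set t | forall i, A i (tnth t i)] =
  (\prod_(i < m) lebesgue_measure (A i))%E.
Proof.
elim: m A => [|m IH] A mA /=.
  by rewrite big_ord0 diracE mem_set//=; case.
rewrite /lebesgue_cons /pushforward big_ord_recl -IH//.
rewrite -product_measure1E; [|exact: mA|]; last first.
  rewrite [X in measurable X](_ : _ =
      \bigcap_(i in [set: 'I_m]) ((fun t => tnth t i) @^-1` A (lift ord0 i))).
    apply: fin_bigcap_measurable => //= i _.
    by rewrite -[X in measurable X]setTI; exact: measurable_tnth.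
  by apply/seteqP; split=> t /= At i; [move=> _|]; exact: At.
apply: (congr1 (product_measure1 _ _)); apply/seteqP; split=> -[x t]/=.
  move=> At; split; first exact: (At ord0).
  by move=> i; have := At (lift ord0 i); rewrite tnthS.
move=> [Ax At] i; case: (unliftP ord0 i) => [j ->|->]; last by [].
by rewrite tnthS; exact: At.
Qed.

End LebesgueTuple.

Section BetaBinomialLogit.
Context {R : realType}.
Local Notation mu := (@lebesgue_measure R).

Definition beta_function (a b : R) : R :=
  (\int[mu]_(v in `]0, 1[) (v `^ (a - 1) * (1 - v) `^ (b - 1)))%R.

Variables (k m : nat) (X : 'M[R]_(k, m)).

(* x_j^T b, where x_j is the j-th row of X *)
Definition linear_predictor (b : m.-tuple R) (j : 'I_k) : R :=
  (X *m \col_i tnth b i) j ord0.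

Definition pE (b : m.-tuple R) (j : 'I_k) : R :=
  expR (linear_predictor b j) / (1 + expR (linear_predictor b j)).

Definition qE (b : m.-tuple R) (j : 'I_k) : R := 1 - pE b j.

Variables n y : 'I_k -> nat.

Definition likelihood (r : R) (b : m.-tuple R) : R :=
  \prod_(j < k)
    ('C(n j, y j)%:R *
     (beta_function ((y j)%:R + r * pE b j)
                    ((n j)%:R - (y j)%:R + r * qE b j) /
      beta_function (r * pE b j) (r * qE b j))).

Definition posterior_kernel (f : R -> R) (g : m.-tuple R -> R)
    (r : R) (b : m.-tuple R) : R :=
  f r * g b * likelihood r b.

Definition posterior_mass (f : R -> R) (g : m.-tuple R -> R) : \bar R :=
  (\int[lebesgue_tuple m]_b
     \int[mu]_(r in `]0%R, +oo[) (posterior_kernel f g r b)%:E)%E.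

Definition posterior_proper (f : R -> R) (g : m.-tuple R -> R) : Prop :=
  (posterior_mass f g < +oo)%E.

End BetaBinomialLogit.

Definition proper_density_pos (R : realType) (f : R -> R) : Prop :=
  [/\ measurable_fun (`]0%R, +oo[ : set R) f,
      forall r, 0 < r -> 0 <= f r &
      (\int[lebesgue_measure]_(r in `]0%R, +oo[) (f r)%:E = 1)%E].

Definition flat_density (R : realType) (m : nat) (g : m.-tuple R -> R) : Prop :=
  exists2 c : R, 0 < c & forall b, g b = c.

(* Main.v *)
(* With r^(n) = r (r + 1) ... (r + n - 1), the beta function recurrences give
   L_j = C(n_j, y_j) (r p_j)^(y_j) (r q_j)^(n_j - y_j) / r^(n_j). As both y_j and
   n_j - y_j are positive, L_j <= C(n_j, y_j) p_j q_j uniformly in r, and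
   p_j q_j <= exp(-|x_j^T b|). If X has a left inverse then
   sum_j |x_j^T b| >= c sum_i |b_i|, so L is dominated by a product of Laplace
   kernels in the b_i, independently of r.
   Otherwise pick v in the kernel of X with some coordinate equal to 1: the boxes
   N v + [0, 1[^m, for N in nat, are disjoint of volume 1, and the x_j^T b are
   bounded on their union, where hence L >= d min(r, 1)^M for some d > 0. *)
Require Import Defs.
From HB Require Import structures.
From mathcomp Require Import all_boot all_order all_algebra.
From mathcomp Require Import all_classical all_reals all_analysis.
From mathcomp Require Import measurable_realfun ring lra.
Set Implicit Arguments.
Unset Strict Implicit.
Unset Printing Implicit Defensive.
Import Order.TTheory GRing.Theory Num.Theory.
Import numFieldNormedType.Exports.
Local Open Scope classical_set_scope.
Local Open Scope ring_scope.

(* [ge0_le_integral] without measurability: this avoids having to show that the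
   likelihood is jointly measurable. *)
Lemma ge0_le_integral_nonmeasurable d (T : measurableType d) (R : realType)
    (mu : {measure set T -> \bar R}) (D : set T) (f1 f2 : T -> \bar R) :
  (forall x, D x -> 0 <= f1 x)%E -> (forall x, D x -> f1 x <= f2 x)%E ->
  (\int[mu]_(x in D) f1 x <= \int[mu]_(x in D) f2 x)%E.
Proof.
move=> f10 f12.
have f20 x : D x -> (0 <= f2 x)%E by move=> Dx; rewrite (le_trans (f10 _ Dx))// f12.
rewrite !(integral_mkcond D) !ge0_integralTE//; [|exact: erestrict_ge0..].
apply: ereal_sup_le => _ [h /= hf1 <-]; exists h => //= x.
by rewrite (le_trans (hf1 x))// lee_restrict.
Qed.

(** * Fundamental theorem of calculus on the open unit interval *)

Section FTC_open_unit_interval.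
Context {R : realType}.
Local Notation mu := (@lebesgue_measure R).
(** The shift by 3 keeps [e n] strictly below 1/2 already at n = 0, so that every segment [E n] is
    nondegenerate, as the FTC on a segment requires. *)
Let e n : R := n.+3%:R^-1.
Let E n : set R := `[e n, 1 - e n]%classic.

Let e_gt0 n : 0 < e n. Proof. by rewrite invr_gt0 ltr0n. Qed.

Let e_lt n : e n < 1 - e n.
Proof.
rewrite ltrBrDr -mulr2n -mulr_natr -ltr_pdivlMl ?invr_gt0// mulr1 invrK.
by rewrite ltr_nat.
Qed.

Let e_cvg : e n @[n --> \oo] --> (0 : R).
Proof.
rewrite (_ : e = fun n => harmonic (n + 2)%N); last first.
  by apply/funext => n; rewrite /e /harmonic/= addn2.
by have := @cvg_harmonic R; rewrite -(cvg_shiftn 2).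
Qed.

Let E_sub n : E n `<=` `]0, 1[.
Proof.
move=> x; rewrite /E/= !in_itv/= => /andP[x1 x2].
by rewrite (lt_le_trans (e_gt0 n) x1)/= (le_lt_trans x2)// ltrBlDr ltrDl.
Qed.

Let E_bigcup : \bigcup_n E n = `]0, 1[%classic.
Proof.
apply/seteqP; split => [x [n _]|x]; first exact: E_sub.
rewrite /= in_itv/= => /andP[x0 x1].
have [n nx] : exists n, e n < Num.min x (1 - x).
  have := @cvgr_lt _ _ _ _ e 0 e_cvg (Num.min x (1 - x)).
  by case; [rewrite lt_min x0 subr_gt0|move=> n _ /(_ n)/(_ (leqnn n)); exists n].
exists n => //; move: nx; rewrite lt_min /E/= in_itv/= => /andP[/ltW ->/=].
by rewrite ltrBrDr -ltrBrDl => /ltW.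
Qed.

Let E_nd : nondecreasing_seq E.
Proof.
move=> m n mn; apply/subsetPset => x; rewrite /E/= !in_itv/= => /andP[h1 h2].
have emn : e n <= e m by rewrite lef_pV2 ?posrE ?ltr0n// ler_nat !ltnS.
by rewrite (le_trans emn h1)/= (le_trans h2)// lerB.
Qed.

(* Written as [int u = int w + (B - A)], no integrability of [u] or [w] is
   needed. *)
Lemma ge0_FTC_oo (F u w : R -> R) (A B : R) :
  {in `]0, 1[, forall x, 0 <= u x} -> {in `]0, 1[, forall x, 0 <= w x} ->
  {in `]0, 1[, continuous u} -> {in `]0, 1[, continuous w} ->
  {in `]0, 1[, forall x : R, is_derive x 1 F (u x - w x)} ->
  F x @[x --> 0^'+] --> A -> F x @[x --> 1^'-] --> B ->
  (\int[mu]_(x in `]0%R, 1%R[) (u x)%:E =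
   \int[mu]_(x in `]0%R, 1%R[) (w x)%:E + (B - A)%:E)%E.
Proof.
move=> u0 w0 cu cw dF FA FB.
have mE n : measurable (E n) by exact: measurable_itv.
have Ein n x : x \in E n -> x \in `]0%R, 1%R[ by rewrite inE => /E_sub.
have cE (h : R -> R) : {in `]0, 1[, continuous h} ->
    forall n, {within E n, continuous h}.
  by move=> ch n; apply: continuous_in_subspaceT => x /Ein; exact: ch.
have iE (h : R -> R) : {in `]0, 1[, continuous h} ->
    forall n, mu.-integrable (E n) (EFin \o h).
  move=> ch n; apply: continuous_compact_integrable; last exact: cE.
  exact: segment_compact.
have intE (h : R -> R) : {in `]0, 1[, continuous h} ->
    {in `]0, 1[, forall x, 0 <= h x} ->
    (\int[mu]_(x in E n) (h x)%:E @[n --> \oo] -->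
     \int[mu]_(x in `]0%R, 1%R[) (h x)%:E)%E.
  move=> ch h0; rewrite -E_bigcup.
  apply: ge0_nondecreasing_set_cvg_integral => //.
  - by move=> n; exact: (measurable_int mu (iE h ch n)).
  - by move=> n x /mem_set/Ein /h0; rewrite lee_fin.
(* On the compact [E n] both [u] and [w] are continuous, hence integrable, so the FTC for [u - w]
   may be split and rearranged into a sum. *)
have step n : (\int[mu]_(x in E n) (u x)%:E =
    \int[mu]_(x in E n) (w x)%:E + (F (1 - e n) - F (e n))%:E)%E.
  have sub : {in `]e n, 1 - e n[, forall x : R, x \in `]0%R, 1%R[}.
    by move=> x xe; apply: (@Ein n); rewrite inE; exact: subset_itv_oo_cc xe.
  have Fc x : x \in `]0%R, 1%R[ -> {for x, continuous F}.
    move=> /dF dFx; apply: differentiable_continuous; apply/derivable1_diffP.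
    exact: ex_derive.
  have e01 : e n \in `]0%R, 1%R[.
    by apply: (@Ein n); rewrite inE /E/= in_itv/= lexx ltW.
  have e11 : 1 - e n \in `]0%R, 1%R[.
    by apply: (@Ein n); rewrite inE /E/= in_itv/= lexx ltW.
  have := @continuous_FTC2 R (u \- w) F (e n) (1 - e n) (e_lt n).
  have cuw : {within E n, continuous (u \- w)}.
    by apply: cE => x x01; apply: cvgB; [exact: cu|exact: cw].
  have dFn : derivable_oo_LRcontinuous F (e n) (1 - e n).
    split; [|exact/cvg_at_right_filter/Fc|exact/cvg_at_left_filter/Fc].
    by move=> x /sub/dF ?; exact: ex_derive.
  have dFE : {in `](e n), (1 - e n)[, F^`()%classic =1 u \- w}.
    by move=> x /sub/dF ?; rewrite derive1E derive_val.
  move=> /(_ cuw dFn dFE).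
  under eq_integral do rewrite EFinB.
  rewrite integralB_EFin//; [|exact: iE..].
  move=> h; rewrite EFinB -h addeC subeK//.
  by apply: integrable_fin_num => //; exact: iE.
have F0 : F (e n) @[n --> \oo] --> A.
  by have /cvg_at_rightP := FA; apply; split.
have F1 : F (1 - e n) @[n --> \oo] --> B.
  have /cvg_at_leftP := FB; apply; split=> [n|]; first by rewrite ltrBlDr ltrDl.
  by rewrite -[X in _ --> X]subr0; apply: cvgB => //; exact: cvg_cst.
have lu := intE u cu u0; have lw := intE w cw w0.
(* Both sides are limits of the same sequence. As [B - A] is finite, the limit of the sum is defined
   even if the integral of [w] is infinite. *)
apply: (cvg_unique _ lu); first exact: ereal_hausdorff.
rewrite /=; under eq_fun do rewrite step.
apply: cvgeD => //; first by rewrite fin_num_adde_defl.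
by apply: cvg_EFin; [exact: nearW|apply: cvgB].
Qed.

End FTC_open_unit_interval.

(** If the integral of [f * w] vanished, then [f * w], and hence [f], would be zero almost
    everywhere. This gives the positivity of the beta function ([f] constant 1) and that of the
    radial constant in the divergence argument ([f] the hyper-prior of r). *)
Lemma integral_mul_gt0 d (T : measurableType d) (R : realType)
    (mu : {measure set T -> \bar R}) (D : set T) (f w : T -> R) :
  measurable D -> measurable_fun D f -> measurable_fun D w ->
  (forall x, D x -> 0 <= f x) -> (forall x, D x -> 0 < w x) ->
  (\int[mu]_(x in D) (f x)%:E)%E != 0%E ->
  (0 < \int[mu]_(x in D) (f x * w x)%:E)%E.
Proof.
move=> mD mf mw f0 w0 If0; rewrite lt0e integral_ge0 ?andbT; last first.
  by move=> x Dx; rewrite lee_fin mulr_ge0 ?f0// ltW// w0.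
apply: contra If0 => /eqP Ifw; apply/eqP.
have mfE : measurable_fun D (EFin \o f) by exact/measurable_EFinP.
have mfwE : measurable_fun D (fun x => (f x * w x)%:E).
  by apply/measurable_EFinP; exact: measurable_funM.
have normE (h : T -> R) : (forall x, D x -> 0 <= h x) ->
    (\int[mu]_(x in D) `|(h x)%:E| = \int[mu]_(x in D) (h x)%:E)%E.
  move=> h0; apply: eq_integral => x /set_mem Dx.
  by rewrite gee0_abs// lee_fin h0.
rewrite -normE//; apply/(ae_eq_integral_abs mu mD mfE).
have fw0 x : D x -> 0 <= f x * w x by move=> Dx; rewrite mulr_ge0 ?f0// ltW// w0.
have /(ae_eq_integral_abs mu mD mfwE) := etrans (normE _ fw0) Ifw.
apply: filterS => x fwx Dx; have [/eqP] := fwx Dx.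
by rewrite mulf_eq0 (gt_eqF (w0 x Dx)) orbF => /eqP /= ->.
Qed.

(** * The beta function *)

Section beta_function_theory.
Context {R : realType}.
Local Notation mu := (@lebesgue_measure R).
Implicit Types a b x : R.

Lemma is_derive_powR_onem b x : x < 1 ->
  is_derive x 1 (fun v => (1 - v) `^ b) (- (b * (1 - x) `^ (b - 1))).
Proof.
move=> x1; have x0 : 0 < 1 - x by rewrite subr_gt0.
have dg : is_derive x 1 (fun v : R => 1 - v) (-1).
  by apply: is_derive_eq; rewrite add0r mul1r.
have := @is_derive1_comp R (fun z => z `^ b) (fun v => 1 - v) x _ _
  (is_derive1_powR b x0) dg.
by rewrite mulrN1.
Qed.

Lemma continuous_powR_gt0 a x : 0 < x -> {for x, continuous (fun v => v `^ a)}.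
Proof.
move=> x0; apply: differentiable_continuous; apply/derivable1_diffP.
by have h := is_derive1_powR a x0; exact: ex_derive.
Qed.

Lemma continuous_powR_onem_lt1 b x : x < 1 ->
  {for x, continuous (fun v : R => (1 - v) `^ b)}.
Proof.
move=> x1; apply: differentiable_continuous; apply/derivable1_diffP.
by have h := is_derive_powR_onem b x1; exact: ex_derive.
Qed.

Lemma powR_onem_cvg0 b : 0 < b -> (1 - v) `^ b @[v --> 1^'-] --> (0 : R).
Proof.
move=> b0; apply/cvg_at_leftP => u [u1 uc].
have /cvg_at_rightP := powR_cvg0 b0; apply; split=> [n|]; first by rewrite subr_gt0.
by rewrite -(subrr 1); apply: cvgB => //; exact: cvg_cst.
Qed.

Lemma powR_cvg1 a : v `^ a @[v --> 1^'-] --> (1 : R).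
Proof.
rewrite -[X in _ --> X](_ : 1 `^ a = 1); last by rewrite powR1.
exact/cvg_at_left_filter/continuous_powR_gt0.
Qed.

Lemma powR_onem_cvg1 b : (1 - v) `^ b @[v --> 0^'+] --> (1 : R).
Proof.
rewrite -[X in _ --> X](_ : (1 - 0) `^ b = 1); last by rewrite subr0 powR1.
exact/cvg_at_right_filter/continuous_powR_onem_lt1.
Qed.

(** For a < 1 the integrand is unbounded at 0, so the FTC on the open interval is applied, with [w]
    equal to 0 and antiderivative v^a / a. *)
Lemma integral_powR_oo a : 0 < a ->
  (\int[mu]_(v in `]0%R, 1%R[) (v `^ (a - 1))%:E = a^-1%:E)%E.
Proof.
move=> a0; rewrite (@ge0_FTC_oo R (fun v => a^-1 * v `^ a) _ (cst 0) 0 a^-1).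
- by rewrite integral0 add0e subr0.
- by move=> x _; exact: powR_ge0.
- by [].
- by move=> x; rewrite in_itv/= => /andP[x0 _]; exact: continuous_powR_gt0.
- by move=> x _; exact: cvg_cst.
- move=> x; rewrite in_itv/= => /andP[x0 _].
  have h := is_derive1_powR a x0.
  apply: is_derive_eq; rewrite subr0 /GRing.scale/=.
  by rewrite mulrA mulVf ?gt_eqF// mul1r.
- rewrite -[X in _ --> X](mulr0 a^-1); apply: cvgM; first exact: cvg_cst.
  exact: powR_cvg0.
- rewrite -[X in _ --> X](mulr1 a^-1); apply: cvgM; first exact: cvg_cst.
  exact: powR_cvg1.
Qed.

Lemma integral_powR_onem_oo b : 0 < b ->
  (\int[mu]_(v in `]0%R, 1%R[) ((1 - v) `^ (b - 1))%:E = b^-1%:E)%E.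
Proof.
move=> b0; rewrite (@ge0_FTC_oo R (fun v => - b^-1 * (1 - v) `^ b) _ (cst 0)
  (- b^-1) 0).
- by rewrite integral0 add0e opprK add0r.
- by move=> x _; exact: powR_ge0.
- by [].
- by move=> x; rewrite in_itv/= => /andP[_ x1]; exact: continuous_powR_onem_lt1.
- by move=> x _; exact: cvg_cst.
- move=> x; rewrite in_itv/= => /andP[_ x1].
  have h := is_derive_powR_onem b x1.
  apply: is_derive_eq; rewrite subr0 /GRing.scale/=.
  by rewrite mulrNN mulrA mulVf ?gt_eqF// mul1r.
- rewrite -[X in _ --> X](mulr1 (- b^-1)); apply: cvgM; first exact: cvg_cst.
  exact: powR_onem_cvg1.
- rewrite -[X in _ --> X](mulr0 (- b^-1)); apply: cvgM; first exact: cvg_cst.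
  exact: powR_onem_cvg0.
Qed.

Definition beta_kernel a b (v : R) : R := v `^ (a - 1) * (1 - v) `^ (b - 1).

Lemma beta_kernel_ge0 a b v : 0 <= beta_kernel a b v.
Proof. by rewrite mulr_ge0 ?powR_ge0. Qed.

Lemma continuous_beta_kernel a b : {in `]0, 1[, continuous (beta_kernel a b)}.
Proof.
move=> x; rewrite in_itv/= => /andP[x0 x1].
by apply: cvgM; [exact: continuous_powR_gt0|exact: continuous_powR_onem_lt1].
Qed.

Lemma beta_kernelSl a b v : 0 < v ->
  beta_kernel (a + 1) b v = v * beta_kernel a b v.
Proof.
move=> v0; rewrite /beta_kernel mulrA; congr (_ * _).
rewrite addrK -{1}[a in LHS](subrK 1 a) (@powRD R v (a - 1) 1); last by rewrite (gt_eqF v0) implybT.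
by rewrite powRr1 ?ltW// mulrC.
Qed.

Lemma beta_kernelSr a b v : v < 1 ->
  beta_kernel a (b + 1) v = (1 - v) * beta_kernel a b v.
Proof.
rewrite -subr_gt0 => v0; rewrite /beta_kernel mulrCA; congr (_ * _).
rewrite addrK -{1}[b in LHS](subrK 1 b) (@powRD R (1 - v) (b - 1) 1); last by rewrite (gt_eqF v0) implybT.
by rewrite powRr1 ?ltW// mulrC.
Qed.

Lemma beta_kernelD a b v : 0 < v < 1 ->
  beta_kernel a b v = beta_kernel (a + 1) b v + beta_kernel a (b + 1) v.
Proof.
move=> /andP[v0 v1]; rewrite beta_kernelSl// beta_kernelSr//.
by rewrite -mulrDl addrC subrK mul1r.
Qed.

Lemma powR_le1 a x : 0 <= x <= 1 -> 0 <= a -> x `^ a <= 1.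
Proof.
move=> /andP[x0 x1] a0; rewrite -[leRHS](_ : 1 `^ a = 1); last by rewrite powR1.
by rewrite ge0_ler_powR// nnegrE.
Qed.

(* Since v + (1 - v) = 1, the kernel is v^(a-1) (1-v)^b + v^a (1-v)^(b-1). *)
Lemma beta_kernel_le a b v : 0 < a -> 0 < b -> 0 < v < 1 ->
  beta_kernel a b v <= v `^ (a - 1) + (1 - v) `^ (b - 1).
Proof.
move=> a0 b0 v01; rewrite beta_kernelD// /beta_kernel !addrK addrC.
have /andP[v0 v1] := v01; apply: lerD.
  rewrite ler_piMr ?powR_ge0// powR_le1 ?(ltW b0)//.
  by rewrite subr_ge0 (ltW v1) lerBlDr lerDl ltW.
by rewrite ler_piMl ?powR_ge0// powR_le1 ?(ltW a0)// (ltW v0) (ltW v1).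
Qed.

Let measurable_oo : measurable (`]0, 1[%classic : set (measurableTypeR R)).
Proof. exact: measurable_itv. Qed.

Lemma measurable_oo_continuous (f : R -> R) :
  {in `]0, 1[, continuous f} -> measurable_fun (`]0, 1[%classic : set (measurableTypeR R)) f.
Proof.
move=> cf; apply: open_continuous_measurable_fun; first exact: interval_open.
exact/in_continuous_mksetP.
Qed.

Lemma measurable_beta_kernel a b :
  measurable_fun (`]0, 1[%classic : set (measurableTypeR R)) (beta_kernel a b).
Proof. by apply: measurable_oo_continuous; exact: continuous_beta_kernel. Qed.

(** The domination [beta_kernel_le] bounds the integral by 1/a + 1/b, also for parameters below 1,
    where the kernel is unbounded. *)
Lemma integrable_beta_kernel a b : 0 < a -> 0 < b ->
  mu.-integrable `]0, 1[ (EFin \o beta_kernel a b).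
Proof.
move=> a0 b0; apply/integrableP; split.
  apply/measurable_EFinP; exact: measurable_beta_kernel.
apply: (@le_lt_trans _ _ (\int[mu]_(v in `]0%R, 1%R[)
    ((v `^ (a - 1))%:E + ((1 - v) `^ (b - 1))%:E))%E).
  apply: ge0_le_integral_nonmeasurable => // v; rewrite /= in_itv/= => v01.
  by rewrite lee_fin ger0_norm ?beta_kernel_ge0// beta_kernel_le.
rewrite ge0_integralD//.
- by rewrite integral_powR_oo// integral_powR_onem_oo// -EFinD ltry.
- by move=> v _; rewrite lee_fin powR_ge0.
- apply/measurable_EFinP; apply: measurable_oo_continuous => x.
  by rewrite in_itv/= => /andP[x0 _]; exact: continuous_powR_gt0.
- by move=> v _; rewrite lee_fin powR_ge0.
- apply/measurable_EFinP; apply: measurable_oo_continuous => x.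
  by rewrite in_itv/= => /andP[_ x1]; exact: continuous_powR_onem_lt1.
Qed.

(** [beta_function] is [fine] of an extended integral, which would be 0 if that integral were
    infinite; integrability excludes this. *)
Lemma EFin_beta_function a b : 0 < a -> 0 < b ->
  ((beta_function a b)%:E = \int[mu]_(v in `]0%R, 1%R[) (beta_kernel a b v)%:E)%E.
Proof.
move=> a0 b0; rewrite /beta_function /Rintegral fineK//.
have := integrable_fin_num measurable_oo (integrable_beta_kernel a0 b0).
by apply.
Qed.

Lemma beta_function_ge0 a b : 0 <= beta_function a b.
Proof. by apply: Rintegral_ge0 => v _; exact: beta_kernel_ge0. Qed.

Lemma beta_function_gt0 a b : 0 < a -> 0 < b -> 0 < beta_function a b.
Proof.
move=> a0 b0; rewrite -lte_fin EFin_beta_function//.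
under eq_integral do rewrite -[beta_kernel _ _ _]mul1r.
apply: (integral_mul_gt0 (f := cst 1)) => //.
- exact: measurable_beta_kernel.
- move=> x /=; rewrite in_itv/= => /andP[x0 x1].
  by rewrite mulr_gt0// powR_gt0// subr_gt0.
- rewrite (eq_integral (cst 1%E))// integral_cst//= lebesgue_measure_itv/= lte_fin ltr01 oppr0 adde0.
  by rewrite mule1 eqe oner_eq0.
Qed.

Lemma beta_functionD a b : 0 < a -> 0 < b ->
  beta_function a b = beta_function (a + 1) b + beta_function a (b + 1).
Proof.
move=> a0 b0; rewrite /beta_function -RintegralD//.
- by apply: eq_Rintegral => v; rewrite inE/= in_itv/= => /(beta_kernelD a b).
- by apply: (@integrable_beta_kernel (a + 1) b) => //; rewrite addr_gt0.
- by apply: (@integrable_beta_kernel a (b + 1)) => //; rewrite addr_gt0.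
Qed.

(* Integration by parts: v^a (1-v)^b vanishes at both ends. *)
Lemma beta_function_parts a b : 0 < a -> 0 < b ->
  a * beta_function a (b + 1) = b * beta_function (a + 1) b.
Proof.
move=> a0 b0; have a1 : 0 < a + 1 by rewrite addr_gt0.
have b1 : 0 < b + 1 by rewrite addr_gt0.
apply: EFin_inj; rewrite !EFinM (EFin_beta_function a0 b1) (EFin_beta_function a1 b0).
have iZ c (a' b' : R) : 0 <= c ->
    (c%:E * \int[mu]_(v in `]0%R, 1%R[) (beta_kernel a' b' v)%:E =
     \int[mu]_(v in `]0%R, 1%R[) (c * beta_kernel a' b' v)%:E)%E.
  move=> c0; under [RHS]eq_integral do rewrite EFinM.
  rewrite (ge0_integralZl mu measurable_oo)//.
  - by apply/measurable_EFinP; exact: measurable_beta_kernel.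
  - by move=> v _; rewrite lee_fin beta_kernel_ge0.
rewrite (iZ _ _ _ (ltW a0)) (iZ _ _ _ (ltW b0)).
have cZ c (a' b' : R) : {in `]0, 1[, continuous (fun v => c * beta_kernel a' b' v)}.
  move=> x x01; apply: cvgM; first exact: cvg_cst.
  exact: continuous_beta_kernel.
rewrite (@ge0_FTC_oo R (fun v => v `^ a * (1 - v) `^ b) _
  (fun v => b * beta_kernel (a + 1) b v) 0 0)//.
- by rewrite subrr adde0.
- by move=> v _; rewrite mulr_ge0 ?beta_kernel_ge0 ?ltW.
- by move=> v _; rewrite mulr_ge0 ?beta_kernel_ge0 ?ltW.
- move=> x; rewrite in_itv/= => /andP[x0 x1].
  have h1 := is_derive1_powR a x0; have h2 := is_derive_powR_onem b x1.
  apply: is_derive_eq; rewrite /beta_kernel !addrK /GRing.scale/=.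
  ring.
- rewrite -[X in _ --> X](mul0r 1); apply: cvgM; first exact: powR_cvg0.
  exact: powR_onem_cvg1.
- rewrite -[X in _ --> X](mul1r 0); apply: cvgM; first exact: powR_cvg1.
  exact: powR_onem_cvg0.
Qed.

(** [beta_functionD] and [beta_function_parts] are two linear equations in the two shifted values;
    multiplying by a + b solves them. *)
Lemma beta_functionSl a b : 0 < a -> 0 < b ->
  beta_function (a + 1) b = a / (a + b) * beta_function a b.
Proof.
move=> a0 b0; have ab0 : a + b != 0 by rewrite gt_eqF ?addr_gt0.
apply: (mulfI ab0); rewrite mulrA mulrCA (mulfV ab0) mulr1 (beta_functionD a0 b0).
by rewrite mulrDr (beta_function_parts a0 b0) mulrDl.
Qed.

Lemma beta_functionSr a b : 0 < a -> 0 < b ->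
  beta_function a (b + 1) = b / (a + b) * beta_function a b.
Proof.
move=> a0 b0; have ab0 : a + b != 0 by rewrite gt_eqF ?addr_gt0.
apply: (mulfI ab0); rewrite mulrA mulrCA (mulfV ab0) mulr1 (beta_functionD a0 b0).
by rewrite mulrDr -(beta_function_parts a0 b0) mulrDl.
Qed.

(** The Pochhammer symbol, Gamma(a + n) / Gamma(a) for a > 0. *)
Definition rising a n : R := \prod_(i < n) (a + i%:R).

Lemma risingS a n : rising a n.+1 = rising a n * (a + n%:R).
Proof. by rewrite /rising big_ord_recr. Qed.

Lemma rising_gt0 a n : 0 < a -> 0 < rising a n.
Proof. by move=> a0; apply: prodr_gt0 => i _; rewrite ltr_wpDr. Qed.

Lemma rising_add a m n : rising a (m + n) = rising a m * rising (a + m%:R) n.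
Proof.
rewrite /rising big_split_ord/=; congr (_ * _).
by apply: eq_bigr => i _; rewrite natrD addrA.
Qed.

(** The recurrences are iterated: first on the second argument with m = 0, then on the first, each
    step adding one factor to the numerator and one to the denominator. *)
Lemma beta_function_rising a b m n : 0 < a -> 0 < b ->
  beta_function (a + m%:R) (b + n%:R) =
  rising a m * rising b n / rising (a + b) (m + n) * beta_function a b.
Proof.
move=> a0 b0; elim: m => [|m IHm].
  rewrite addr0 add0n; elim: n => [|n IHn].
    by rewrite addr0 /rising !big_ord0 !mul1r invr1 mul1r.
  rewrite -addn1 natrD addrA beta_functionSr ?IHn ?ltr_wpDr//.
  rewrite addn1 !risingS -!addrA addrA.
  have h1 : rising (a + b) n != 0 by rewrite gt_eqF ?rising_gt0 ?addr_gt0.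
  have h2 : a + b + n%:R != 0 by rewrite gt_eqF// ltr_wpDr ?addr_gt0.
  by field; rewrite h1 h2.
rewrite -addn1 natrD addrA beta_functionSl ?IHm ?ltr_wpDr//.
rewrite addn1 addSn !risingS natrD.
have h1 : rising (a + b) (m + n) != 0 by rewrite gt_eqF ?rising_gt0 ?addr_gt0.
have h2 : a + b + (m%:R + n%:R) != 0 by rewrite gt_eqF// ltr_wpDr ?addr_ge0 ?addr_gt0.
by field; rewrite h1 h2.
Qed.

End beta_function_theory.

(** * Bounds on the likelihood *)

Section likelihood_bounds.
Context {R : realType}.
Implicit Types (r p t K : R) (m n : nat).

(** The parameters r p and r (1 - p) add up to r, so the denominator no longer depends on p. *)
Lemma beta_ratio r p n y : 0 < r -> 0 < p < 1 -> (y <= n)%N ->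
  beta_function (y%:R + r * p) (n%:R - y%:R + r * (1 - p)) /
  beta_function (r * p) (r * (1 - p)) =
  rising (r * p) y * rising (r * (1 - p)) (n - y) / rising r n.
Proof.
move=> r0 /andP[p0 p1] yn.
have a0 : 0 < r * p by rewrite mulr_gt0.
have b0 : 0 < r * (1 - p) by rewrite mulr_gt0// subr_gt0.
rewrite -natrB// ![_%:R + _]addrC beta_function_rising// subnKC//.
rewrite -mulrDr [p + _]addrC subrK mulr1 mulfK//.
by rewrite gt_eqF// beta_function_gt0.
Qed.

(** The factor of index 0 yields exactly p, and every other one satisfies r p + i <= r + i. That a
    factor of index 0 exists is where interiority of the groups enters. *)
Lemma rising_scale_le r p m : 0 < r -> 0 < p <= 1 -> (0 < m)%N ->
  rising (r * p) m <= p * rising r m.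
Proof.
move=> r0 /andP[p0 p1]; case: m => // m _.
rewrite /rising !big_ord_recl !addr0 mulrA [p * r]mulrC.
rewrite ler_pM2l ?mulr_gt0//; apply: ler_prod => i _.
by rewrite addr_ge0 ?mulr_ge0 ?(ltW r0) ?(ltW p0)//= lerD2r ler_piMr// ltW.
Qed.

Lemma rising_scale_ge r p e m : 0 < r -> 0 <= e -> e <= p -> e <= 1 ->
  e ^+ m * rising r m <= rising (r * p) m.
Proof.
move=> r0 e0 ep e1; rewrite -[X in _ ^+ X]card_ord -prodr_const -big_split/=.
apply: ler_prod => i _; rewrite mulr_ge0 ?addr_ge0 ?(ltW r0)//= mulrDr lerD//.
  by rewrite mulrC ler_wpM2l// ltW.
by rewrite ler_piMl.
Qed.

Lemma rising_le r r' m : 0 <= r <= r' -> rising r m <= rising r' m.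
Proof.
move=> /andP[r0 rr']; apply: ler_prod => i _.
by rewrite addr_ge0//= lerD2r.
Qed.

(** Splitting the denominator as r^(y) (r + y)^(n - y), the successes give a factor p and the
    failures a factor 1 - p; replacing r by r + y only enlarges the second part. *)
Lemma beta_binomial_le r p n y : 0 < r -> 0 < p < 1 -> (0 < y < n)%N ->
  rising (r * p) y * rising (r * (1 - p)) (n - y) / rising r n <= p * (1 - p).
Proof.
move=> r0 /andP[p0 p1] /andP[y0 yn].
have q0 : 0 < 1 - p by rewrite subr_gt0.
rewrite -{2}(subnKC (ltnW yn)) rising_add ler_pdivrMr; last first.
  by rewrite mulr_gt0 ?rising_gt0// ltr_wpDr.
have -> : p * (1 - p) * (rising r y * rising (r + y%:R) (n - y)) =
  (p * rising r y) * ((1 - p) * rising (r + y%:R) (n - y)) by ring.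
apply: ler_pM.
- by rewrite ltW// rising_gt0// mulr_gt0.
- by rewrite ltW// rising_gt0// mulr_gt0.
- by rewrite rising_scale_le// p0 ltW.
- apply: (le_trans (rising_scale_le r0 _ _)).
  + by rewrite q0 lerBlDr lerDl ltW.
  + by rewrite subn_gt0.
  + by rewrite ler_pM2l// rising_le// (ltW r0)/= lerDl.
Qed.

(** The power of e comes from the lower bounds on p and 1 - p. The power of min(r, 1) / (n + 1) pays
    for the shift from r to r + y in the denominator, a loss that is unbounded as r tends to 0. *)
Lemma beta_binomial_ge r p e n y : 0 < r -> 0 <= e -> e <= p -> e <= 1 - p ->
  (y <= n)%N ->
  (e * (Num.min r 1 / n.+1%:R)) ^+ n <=
  rising (r * p) y * rising (r * (1 - p)) (n - y) / rising r n.
Proof.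
move=> r0 e0 ep eq yn.
have e1 : e <= 1 by rewrite (le_trans ep)// -subr_ge0 (le_trans e0).
set s := _ / _.
have s0 : 0 <= s by rewrite divr_ge0// le_min (ltW r0) ler01.
have s1 : s <= 1.
  by rewrite ler_pdivrMr// mul1r ge_min ler1n orbT.
(* Factorwise s (r + y + i) <= r + i: as y + i <= n, min(r, 1) (r + y + i) <= r + r n <= (r + i) (n
   + 1). *)
have r's : s ^+ (n - y) * rising (r + y%:R) (n - y) <= rising r (n - y).
  rewrite -[X in _ ^+ X]card_ord -prodr_const -big_split/=.
  apply: ler_prod => i _.
  rewrite mulr_ge0 ?addr_ge0 ?(ltW r0)//= /s mulrAC ler_pdivrMr//.
  have yin : (y%:R + i%:R : R) <= n%:R.
    by rewrite -natrD ler_nat -leq_subRL// ltnW.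
  have h1 : Num.min r 1 * (y%:R + i%:R) <= r * n%:R.
    by apply: ler_pM; rewrite ?addr_ge0// ?le_min ?ge_min ?lexx ?(ltW r0) ?ler01.
  have h2 : Num.min r 1 * r <= r by rewrite ler_piMl ?(ltW r0)// ge_min lexx orbT.
  have h3 : 0 <= i%:R * n%:R :> R by rewrite mulr_ge0.
  have h4 : 0 <= i%:R :> R by [].
  rewrite -natr1; lra.
rewrite ler_pdivlMr ?rising_gt0// -{2}(subnKC yn) rising_add.
(* As s <= 1, the exponent n - y of s may be raised to n, which makes the bound uniform in y. *)
apply: (@le_trans _ _ ((e ^+ y * rising r y) *
    (e ^+ (n - y) * (s ^+ (n - y) * rising (r + y%:R) (n - y))))).
  rewrite [X in _ <= X](_ : _ = (e ^+ (y + (n - y)) * s ^+ (n - y)) *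
    (rising r y * rising (r + y%:R) (n - y))); last by rewrite exprD; ring.
  rewrite subnKC// exprMn ler_wpM2r//.
    by rewrite mulr_ge0// ltW// rising_gt0// ltr_wpDr.
  by rewrite ler_wpM2l ?exprn_ge0// ler_wiXn2l// leq_subr.
apply: ler_pM.
- by rewrite mulr_ge0 ?exprn_ge0// ltW// rising_gt0.
- by rewrite !mulr_ge0 ?exprn_ge0// ltW// rising_gt0// ltr_wpDr.
- exact: rising_scale_ge.
- apply: le_trans (rising_scale_ge (n - y) r0 e0 eq e1).
  by rewrite ler_wpM2l ?exprn_ge0.
Qed.

Let expit t : R := expR t / (1 + expR t).

Let expit_gt0 t : 0 < expit t.
Proof. by rewrite divr_gt0 ?expR_gt0// addr_gt0 ?expR_gt0. Qed.

Let onem_expit t : 1 - expit t = expit (- t).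
Proof.
rewrite /expit expRN; have h := expR_gt0 t.
by field; rewrite !gt_eqF//= addr_gt0.
Qed.

Let expit_lt1 t : expit t < 1.
Proof. by rewrite -subr_gt0 onem_expit. Qed.

Let expit_le t : expit t <= expR t.
Proof.
rewrite ler_pdivrMr ?addr_gt0 ?expR_gt0//.
by rewrite ler_peMr ?expR_ge0// lerDl expR_ge0.
Qed.

(** By the symmetry [onem_expit], the factor whose argument is -|t| is at most its exponential, and
    the other is at most 1. *)
Let expit_mul_le t : expit t * (1 - expit t) <= expR (- `|t|).
Proof.
rewrite onem_expit; case: ger0P => t0.
  by rewrite (le_trans _ (expit_le _))// ler_piMl// ltW.
by rewrite opprK (le_trans _ (expit_le _))// ler_piMr// ltW.
Qed.

(** The constant is [expit (- K)], and [expit] is increasing. *)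
Let expit_ge t K : `|t| <= K -> (1 + expR K)^-1 <= expit t.
Proof.
rewrite ler_norml => /andP[tK _].
have -> : expit t = (1 + expR (- t))^-1.
  rewrite /expit expRN; have h := expR_gt0 t.
  by field; rewrite !gt_eqF//= ?addr_gt0.
by rewrite lef_pV2 ?posrE ?addr_gt0 ?expR_gt0// lerD2l ler_expR lerNl.
Qed.

Lemma likelihood_ge0 (k m : nat) (X : 'M[R]_(k, m)) (n y : 'I_k -> nat) r
    (b : m.-tuple R) : 0 <= likelihood X n y r b.
Proof.
by apply: prodr_ge0 => j _; rewrite mulr_ge0 ?divr_ge0 ?beta_function_ge0.
Qed.

Lemma likelihoodE (k m : nat) (X : 'M[R]_(k, m)) (n y : 'I_k -> nat) r
    (b : m.-tuple R) : 0 < r -> (forall j, (y j <= n j)%N) ->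
  likelihood X n y r b = \prod_(j < k) ('C(n j, y j)%:R *
    (rising (r * pE X b j) (y j) * rising (r * (1 - pE X b j)) (n j - y j) /
     rising r (n j))).
Proof.
move=> r0 yn; apply: eq_bigr => j _; rewrite /qE beta_ratio//.
by rewrite expit_gt0 expit_lt1.
Qed.

Lemma likelihood_le (k m : nat) (X : 'M[R]_(k, m)) (n y : 'I_k -> nat) r
    (b : m.-tuple R) : 0 < r -> (forall j, (0 < y j < n j)%N) ->
  likelihood X n y r b <=
  \prod_(j < k) 'C(n j, y j)%:R * expR (- \sum_(j < k) `|linear_predictor X b j|).
Proof.
move=> r0 yn; rewrite likelihoodE//; last by move=> j; have /andP[_ /ltnW] := yn j.
rewrite -sumrN expR_sum -big_split/=; apply: ler_prod => j _.
have p01 : 0 < pE X b j < 1 by rewrite expit_gt0 expit_lt1.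
have /andP[p0 p1] := p01.
rewrite mulr_ge0//=; last first.
  by rewrite divr_ge0 ?mulr_ge0 ?(ltW (rising_gt0 _ _))// mulr_gt0// subr_gt0.
rewrite ler_wpM2l// (le_trans (beta_binomial_le r0 p01 (yn j)))//.
exact: expit_mul_le.
Qed.

(** Bounded linear predictors keep every p_j and 1 - p_j above 1 / (1 + exp K). The constants are
    chosen before r and b, so the bound can be integrated over an unbounded set of b. *)
Lemma likelihood_ge (k m : nat) (X : 'M[R]_(k, m)) (n y : 'I_k -> nat) K :
  (forall j, (y j <= n j)%N) ->
  exists2 c, 0 < c & exists N : nat, forall r (b : m.-tuple R), 0 < r ->
    (forall j, `|linear_predictor X b j| <= K) ->
    c * Num.min r 1 ^+ N <= likelihood X n y r b.
Proof.
move=> yn; pose e : R := (1 + expR K)^-1.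
have e0 : 0 < e by rewrite invr_gt0 addr_gt0 ?expR_gt0.
exists (\prod_(j < k) (e / (n j).+1%:R) ^+ n j).
  by apply: prodr_gt0 => j _; rewrite exprn_gt0// divr_gt0.
exists (\sum_(j < k) n j)%N => r b r0 bK.
have m0 : 0 <= Num.min r 1 by rewrite le_min (ltW r0) ler01.
rewrite likelihoodE// -prodrXr -big_split/=; apply: ler_prod => j _.
rewrite mulr_ge0 ?exprn_ge0 ?divr_ge0 ?(ltW e0)//= -exprMn.
have ep : e <= pE X b j by exact: expit_ge.
have eq : e <= 1 - pE X b j.
  by rewrite [1 - _]onem_expit expit_ge// normrN.
have := beta_binomial_ge r0 (ltW e0) ep eq (yn j).
rewrite mulrA [_ * _ / _]mulrAC => h; rewrite (le_trans h)//.
(* The binomial coefficient is at least 1 and is dropped. *)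
rewrite ler_peMl//; last by rewrite ler1n bin_gt0.
by apply: le_trans h; rewrite exprn_ge0// mulr_ge0// divr_ge0// ltW.
Qed.

End likelihood_bounds.

(** * Integration over R^m *)

Section integral_tuple.
Context {R : realType}.
Local Notation mu := (@lebesgue_measure R).

(** By evenness this is twice the integral over the half-line, where the integrand is 1/c times the
    exponential density of rate c. *)
Lemma integral_expR_norm_lty (c : R) : 0 < c ->
  (\int[mu]_x (expR (- (c * `|x|)))%:E < +oo)%E.
Proof.
move=> c0.
rewrite ge0_symfun_integralT//=; first last.
- by move=> x /=; rewrite normrN.
- move=> x; apply: continuous_comp; last exact: continuous_expR.
  apply: cvgN; apply: cvgM; first exact: cvg_cst.
  exact: norm_continuous.
apply: lte_mul_pinfty => //.
apply: (@le_lt_trans _ _ (\int[mu]_x (c^-1%:E * (exponential_pdf c x)%:E))%E).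
  rewrite integral_mkcond; apply: ge0_le_integral_nonmeasurable => x _.
    by apply: erestrict_ge0 => ? _; rewrite lee_fin expR_ge0.
  rewrite patchE; case: ifPn => [|_]; last first.
    by rewrite -EFinM lee_fin mulr_ge0 ?invr_ge0 ?exponential_pdf_ge0// ltW.
  rewrite inE/= => x0; rewrite -EFinM lee_fin exponential_pdfE//.
  by rewrite mulrA mulVf ?gt_eqF// mul1r ger0_norm// mulNr.
rewrite ge0_integralZl//.
- by rewrite integral_exponential_pdf// mule1 ltry.
- by apply/measurable_EFinP; exact: measurable_exponential_pdf.
- by move=> x _; rewrite lee_fin exponential_pdf_ge0// ltW.
- by rewrite lee_fin invr_ge0 ltW.
Qed.

Lemma measurable_prod_tnth m (h : R -> R) : measurable_fun setT h ->
  measurable_fun setT (fun t : m.-tuple R => \prod_(i < m) h (tnth t i)).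
Proof.
move=> mh; apply: measurable_prod => i _.
by apply: measurableT_comp => //; exact: measurable_tnth.
Qed.

(** Induction on [m]: [lebesgue_tuple] is a pushforward of a product measure, so Tonelli peels off
    the first coordinate; the Dirac mass at the empty tuple gives the initial value 1. *)
Lemma integral_lebesgue_tuple_prod m (h : R -> R) :
  measurable_fun setT h -> (forall x, 0 <= h x) ->
  (\int[lebesgue_tuple m]_t (\prod_(i < m) h (tnth t i))%:E =
   (\int[mu]_x (h x)%:E) ^+ m)%E.
Proof.
move=> mh h0; elim: m => [|m IHm].
  rewrite (eq_integral (cst 1%E)); last by move=> t _; rewrite big_ord0.
  by rewrite integral_cst//= diracT mul1e.
have mp n : measurable_fun setT (fun t : n.-tuple R => \prod_(i < n) h (tnth t i)).
  exact: measurable_prod_tnth.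
have p0 n (t : n.-tuple R) : 0 <= \prod_(i < n) h (tnth t i) by exact: prodr_ge0.
rewrite expeS /= ge0_integral_pushforward//=; first last.
- by move=> t _; rewrite lee_fin; exact: p0.
- by apply/measurable_EFinP; exact: mp.
- exact: measurable_tuple_cons.
rewrite preimage_setT.
pose F (z : measurableTypeR R * m.-tuple R) :=
  ((h z.1)%:E * (\prod_(i < m) h (tnth z.2 i))%:E)%E.
have mF : measurable_fun setT F.
  apply: emeasurable_funM; apply/measurable_EFinP.
    by apply: measurableT_comp => //; exact: measurable_fst.
  exact: (measurableT_comp (mp m) measurable_snd).
rewrite (eq_integral F); last first.
  move=> z _ /=; rewrite /F big_ord_recl EFinM; congr (_ * _)%E.
  by congr EFin; apply: eq_bigr => i _; rewrite tnthS.
rewrite (fubini_tonelli1 F)//; last first.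
  by move=> z; rewrite mule_ge0// lee_fin.
rewrite /fubini_F/= /F/=.
under eq_integral => x _.
  rewrite ge0_integralZl//.
  - by rewrite IHm; over.
  - by apply/measurable_EFinP; exact: mp.
  - by move=> y _; rewrite lee_fin; exact: p0.
  - by rewrite lee_fin.
rewrite ge0_integralZr//.
- exact/measurable_EFinP.
- by move=> x _; rewrite lee_fin.
- by rewrite expe_ge0// integral_ge0// => x _; rewrite lee_fin.
Qed.

End integral_tuple.

(** * Rank of the covariate matrix and size of the linear predictors *)

(** A left inverse Y of X recovers b = Y (X b), so the 1-norm of b is at most that of X b times the
    sum M of the absolute entries of Y. *)
Lemma rank_sum_norm_ge (R : realType) k m (X : 'M[R]_(k, m)) : \rank X = m ->
  exists2 c : R, 0 < c & forall b : m.-tuple R,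
    c * \sum_(i < m) `|tnth b i| <= \sum_(j < k) `|linear_predictor X b j|.
Proof.
move=> rX; have /row_fullP[Y YX] : row_full X by rewrite /row_full rX.
pose M : R := \sum_i \sum_j `|Y i j|.
have M0 : 0 <= M by apply: sumr_ge0 => i _; apply: sumr_ge0.
(* Taking 1 + M instead of M gives a positive quantity to invert without showing M > 0. *)
exists (1 + M)^-1; first by rewrite invr_gt0 ltr_wpDr.
move=> b; set S := \sum_(j < k) _.
have S0 : 0 <= S by exact: sumr_ge0.
rewrite mulrC ler_pdivrMr ?ltr_wpDr//.
apply: (@le_trans _ _ (S * M)); last by rewrite ler_wpM2l// lerDr.
rewrite /M mulr_sumr; apply: ler_sum => i _.
have -> : tnth b i = \sum_j Y i j * linear_predictor X b j.
  have := congr1 (fun A : 'M[R]_m => (A *m \col_i tnth b i) i ord0) YX.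
  by rewrite /= mul1mx -mulmxA [in RHS]mxE => <-; rewrite mxE.
rewrite (le_trans (ler_norm_sum _ _ _))// mulr_sumr; apply: ler_sum => j _.
rewrite normrM mulrC ler_wpM2r// /S (bigD1 j)//= lerDl.
exact: sumr_ge0.
Qed.

(** [kermx] is a left kernel, hence the transposes. The coordinate normalised to 1 serves to make
    the unit boxes at integer multiples of v disjoint. *)
Lemma kernel_vector (R : fieldType) k m (X : 'M[R]_(k, m)) : \rank X != m ->
  exists v : 'cV[R]_m, X *m v = 0 /\ exists i, v i ord0 = 1.
Proof.
move=> rX; have /rowV0Pn[u /sub_kermxP uX u0] : kermx X^T != 0.
  by rewrite kermx_eq0 /row_free mxrank_tr.
have [i ui] : exists i, u 0 i != 0 by exact/rV0Pn.
exists ((u 0 i)^-1 *: u^T); split; last by exists i; rewrite !mxE mulVf.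
by rewrite -scalemxAr -[X]trmxK -trmx_mul uX trmx0 scaler0.
Qed.

Lemma lebesgue_tuple_predictor_le (R : realType) k m (X : 'M[R]_(k, m)) :
  \rank X != m -> exists (K : R) (D : set (m.-tuple R)),
  [/\ measurable D, lebesgue_tuple m D = +oo%E &
      forall b, D b -> forall j, `|linear_predictor X b j| <= K].
Proof.
move=> /kernel_vector[v [Xv [i0 vi0]]].
pose I (N : nat) (i : 'I_m) : set R :=
  `[N%:R * v i ord0, N%:R * v i ord0 + 1[%classic.
pose A N : set (m.-tuple R) := [set t | forall i, I N i (tnth t i)].
have mI N i : measurable (I N i) by exact: measurable_itv.
have mA N : measurable (A N).
  rewrite (_ : A N = \bigcap_(i in [set: 'I_m]) ((fun t => tnth t i) @^-1` I N i)).
    apply: fin_bigcap_measurable => //= i _.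
    by rewrite -[X in measurable X]setTI; exact: measurable_tnth.
  by apply/seteqP; split=> t /= At i; [move=> _|]; exact: At.
have A1 N : lebesgue_tuple m (A N) = 1%E.
  rewrite lebesgue_tuple_box// big1// => i _.
  by rewrite lebesgue_measure_itv/= lte_fin ltrDl ltr01 -EFinB addrAC subrr add0r.
(* The coordinate [i0] of a point of [A N] lies in [N, N + 1[, which determines N. *)
have tA : trivIset setT A.
  apply/trivIsetP => N M _ _ NM; apply/seteqP; split=> // t [/(_ i0) tN /(_ i0)].
  move: tN; rewrite /I/= !in_itv/= vi0 !mulr1 !natr1.
  move=> /andP[a1 a2] /andP[b1 b2].
  have := le_lt_trans a1 b2; have := le_lt_trans b1 a2.
  rewrite !ltr_nat !ltnS => h1 h2; move/eqP: NM; apply.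
  by apply/eqP; rewrite eqn_leq h1 h2.
exists (\sum_j \sum_i `|X j i|), (\bigcup_N A N); split.
- exact: bigcup_measurable.
- rewrite measure_bigcup//.
  have -> : (\sum_(0 <= N <oo | N \in [set: nat]) lebesgue_tuple m (A N) =
      \sum_(0 <= N <oo) (1 : R)%:E)%E.
    by apply: congr_lim; apply/funext => N; apply: eq_big => i; rewrite ?in_setT.
  (* If the series of ones had a finite sum, its terms would tend to 0. *)
  apply/eqP; rewrite eq_le leey/= leNgt; apply/negP.
  have c1 (i : nat) : 0 <= cst 1 i :> R by exact: ler01.
  move=> /(nnseries_is_cvg c1)/cvg_series_cvg_0 c0.
  have /eqP : (0 : R) = 1.
    by apply: (cvg_unique _ c0); [exact: Rhausdorff|exact: cvg_cst].
  by rewrite eq_sym oner_eq0.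
- move=> b [N _ Ab] j.
  (* Since X v = 0, b may be replaced by b - N v, whose coordinates lie in [0, 1[; this explains the
     choice of K as the sum of the absolute entries of X. *)
  have -> : linear_predictor X b j = \sum_i X j i * (tnth b i - N%:R * v i ord0).
    rewrite /linear_predictor mxE.
    under [RHS]eq_bigr do rewrite mulrBr.
    rewrite big_split/= sumrN [X in _ = _ - X](_ : _ = 0) ?subr0.
      by apply: eq_bigr => i _; rewrite mxE.
    under eq_bigr do rewrite mulrCA.
    have := congr1 (fun u : 'cV[R]_k => u j ord0) Xv; rewrite !mxE => h.
    by rewrite -mulr_sumr h mulr0.
  rewrite (le_trans (ler_norm_sum _ _ _))//.
  apply: (@le_trans _ _ (\sum_i `|X j i|)).
    apply: ler_sum => i _; rewrite normrM ler_piMr//.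
    have := Ab i; rewrite /I/= in_itv/= => /andP[h1 h2].
    by rewrite ger0_norm ?subr_ge0// lerBlDl ltW.
  by rewrite [leRHS](bigD1 j)//= lerDl; apply: sumr_ge0 => ? _; exact: sumr_ge0.
Qed.

(** * Propriety of the posterior and full column rank *)

Theorem theorem3p1 (R : realType) (k m : nat)
  (hm : (1 <= m)%N) (hkm : (m <= k)%N)
  (X : 'M[R]_(k, m)) (n y : 'I_k -> nat)
  (hn : forall j, (1 <= n j)%N)
  (hy : forall j, (y j <= n j)%N)
  (hinterior : forall j, (1 <= y j <= n j - 1)%N)
  (f : R -> R) (hf : proper_density_pos f)
  (g : m.-tuple R -> R) (hg : flat_density g) :
  posterior_proper X n y f g <-> \rank X = m.
Proof.
have [mf f0 If] := hf; have [c c0 gc] := hg.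
have f0' r : `]0, +oo[%classic r -> 0 <= f r.
  by rewrite /= in_itv/= andbT => /f0.
have yn j : (0 < y j < n j)%N.
  have /andP[y0 yj] := hinterior j; rewrite y0/=.
  by rewrite (leq_ltn_trans yj)// ltn_subrL hn.
have kern0 r b : 0 < r -> 0 <= posterior_kernel X n y f g r b.
  by move=> /f0 fr; rewrite /posterior_kernel gc !mulr_ge0 ?likelihood_ge0// ltW.
have int0 b : (0 <= \int[lebesgue_measure]_(r in `]0%R, +oo[)
    (posterior_kernel X n y f g r b)%:E)%E.
  by apply: integral_ge0 => r; rewrite /= in_itv/= andbT lee_fin => /kern0.
split=> [proper|rX]; last first.
  have [e e0 eX] := rank_sum_norm_ge rX.
  pose h (x : R) := expR (- (e * `|x|)).
  have h0 x : 0 <= h x by exact: expR_ge0.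
  have mh : measurable_fun setT h.
    apply: measurableT_comp => //; apply: measurableT_comp => //.
    by apply: measurable_funM => //; exact: measurable_normr.
  pose C := c * \prod_(j < k) 'C(n j, y j)%:R.
  have C0 : 0 <= C by rewrite mulr_ge0 ?(ltW c0)// prodr_ge0.
  apply: (@le_lt_trans _ _ (\int[lebesgue_tuple m]_b
      (C%:E * (\prod_(i < m) h (tnth b i))%:E))%E).
    apply: ge0_le_integral_nonmeasurable => // b _.
    have p0 : 0 <= C * \prod_(i < m) h (tnth b i).
      by rewrite mulr_ge0// prodr_ge0.
    (* The bound on the likelihood is free of r, so inserting the total mass 1 of [f] turns it into
       an integral over r, to be compared pointwise. *)
    rewrite -EFinM -[leRHS]mule1 -If -ge0_integralZl//; first last.
    - exact/measurable_EFinP.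
    apply: ge0_le_integral_nonmeasurable => r; rewrite /= in_itv/= andbT => r0.
      by rewrite lee_fin kern0.
    rewrite -EFinM lee_fin /posterior_kernel gc -mulrA [leRHS]mulrC.
    rewrite ler_wpM2l ?f0// /C -mulrA ler_wpM2l ?(ltW c0)//.
    apply: (le_trans (likelihood_le X b r0 yn)).
    rewrite ler_wpM2l ?prodr_ge0// /h -expR_sum ler_expR sumrN lerN2.
    by rewrite -mulr_sumr.
  rewrite ge0_integralZl//; first last.
  - by move=> b _; rewrite lee_fin prodr_ge0.
  - by apply/measurable_EFinP; exact: measurable_prod_tnth.
  rewrite integral_lebesgue_tuple_prod// lte_mul_pinfty//.
  rewrite -ge0_fin_numE; last first.
    by rewrite expe_ge0// integral_ge0// => x _; rewrite lee_fin.
  apply: fin_numX; rewrite ge0_fin_numE ?integral_expR_norm_lty//.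
  by apply: integral_ge0 => x _; rewrite lee_fin.
apply/eqP; apply: contraT => /lebesgue_tuple_predictor_le[K [D [mD Doo DK]]].
have [d d0 [N LN]] := likelihood_ge X K hy.
(* For b in [D] the inner integral is at least [C], the integral of [f * w], which does not depend
   on b. *)
pose w (r : R) := c * (d * Num.min r 1 ^+ N).
pose C := (\int[lebesgue_measure]_(r in `]0%R, +oo[) (f r * w r)%:E)%E.
have C0 : (0 < C)%E.
  apply: integral_mul_gt0 => //.
  - do 2 (apply: measurable_funM => //).
    by apply: measurable_funX; exact: measurable_minr.
  - move=> r; rewrite /= in_itv/= andbT => r0.
    by rewrite !mulr_gt0// exprn_gt0// lt_min r0 ltr01.
  - by rewrite If eqe oner_eq0.
suff : (+oo <= posterior_mass X n y f g)%E.
  by rewrite leye_eq => /eqP mass; move: proper; rewrite /posterior_proper mass.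
(* A positive constant over a set of infinite measure has infinite integral; only [C > 0] matters
   here. *)
have -> : (+oo = \int[lebesgue_tuple m]_(b in D) (cst C) b)%E.
  by rewrite integral_cst//= Doo gt0_muley.
rewrite integral_mkcond; apply: ge0_le_integral_nonmeasurable => b _.
  by apply: erestrict_ge0 => ? _; exact: ltW.
rewrite patchE; case: ifPn => // /set_mem Db.
apply: ge0_le_integral_nonmeasurable => r; rewrite /= in_itv/= andbT => r0.
  by rewrite lee_fin !mulr_ge0 ?f0 ?(ltW c0) ?(ltW d0)// exprn_ge0// le_min (ltW r0) ler01.
rewrite lee_fin /posterior_kernel gc -mulrA ler_wpM2l ?f0// ler_wpM2l ?(ltW c0)//.
by apply: LN => // j; exact: DK.
Qed.
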